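(* Let $d>1$ be a positive integer and let $\kappa_d$ be the smallest size (number of circuits) of a $d$-uniform clutter $\mathcal{C}$ such that the edge ideal $I(\bar{\mathcal{C}})$ of its complement does not have a linear resolution. Then $\kappa_d=2d$. In particular, if $\mathcal{C}$ is a $d$-uniform clutter with $|\mathcal{C}|>\binom{|V(\mathcal{C})|}{d}-2d$, then $I(\mathcal{C})$ has a linear resolution.
   Context: $\mathbb{K}$ is a fixed field. A $d$-uniform clutter $\mathcal{C}$ on a finite vertex set $V=V(\mathcal{C})=\{v_1,\dots,v_n\}$ is a collection of $d$-subsets of $V$ (circuits) with $V=\bigcup\mathcal{C}$; $|\mathcal{C}|$ is its number of circuits. Its complement is $\bar{\mathcal{C}}=\{F\subset V: |F|=d,\ F\notin\mathcal{C}\}$. For a collection $\mathcal{A}$ of $d$-subsets of $V$, the edge ideal is $I(\mathcal{A})=(\prod_{v_i\in F}x_i : F\in\mathcal{A})\subseteq S=\mathbb{K}[x_1,\dots,x_n]$, with $I(\varnothing)=0$. Graded Betti numbers: $\beta_{i,j}(I)=\dim_{\mathbb{K}}\mathrm{Tor}^S_i(\mathbb{K},I)_j$. An ideal generated in degree $d$ has a ($d$-)linear resolution if $\beta_{i,j}(I)=0$ for all $i,j$ with $j-i\ne d$ (so the zero ideal has a linear resolution). *)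

(* Defs.v *)
From HB Require Import structures.
From mathcomp Require Import all_boot all_order all_algebra.
From mathcomp Require Export mpoly.
From mathcomp Require Import ring.

Set Implicit Arguments.
Unset Strict Implicit.
Unset Printing Implicit Defensive.

Import GRing.Theory.
Local Open Scope ring_scope.

Definition is_least (P : nat -> Prop) (m : nat) : Prop :=
  P m /\ (forall k : nat, P k -> (m <= k)%N).

(* dim_K (Z / B) = r, for subspaces B <= Z of a possibly infinite-dimensional
   space: r vectors of Z form a basis modulo B. *)
Definition quotient_dim (K : fieldType) (V : lmodType K) (Z B : V -> Prop)
    (r : nat) : Prop :=
  exists v : 'I_r -> V,
    [/\ forall k, Z (v k),
        forall c : 'I_r -> K, B (\sum_k c k *: v k) -> forall k, c k = 0
      & forall z, Z z -> exists c : 'I_r -> K, B (z - \sum_k c k *: v k)].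

(* p lies in the degree-j component of the twist S(-a), j < a included. *)
Definition twist_homog (K : fieldType) (n a j : nat) (p : {mpoly K[n]}) : bool :=
  if (a <= j)%N then p \is (j - a)%N.-homog else p == 0.

(* Free modules are row vectors, so matrices act on the right. *)
Definition free_map (K : fieldType) (n : nat) (B C : finType)
    (D : B -> C -> {mpoly K[n]}) (v : {ffun B -> {mpoly K[n]}}) :
    {ffun C -> {mpoly K[n]}} :=
  [ffun c => \sum_b v b * D b c].

Definition augment (K : fieldType) (n : nat) (B : finType) (e : B -> K)
    (v : {ffun B -> {mpoly K[n]}}) : K :=
  \sum_b (v b)@_0 * e b.

(* Resolutions of the residue field K = S / (x_1, ..., x_n) by finitely
   generated graded free S-modules F_i = \bigoplus_(b : fr_basis i) S(-fr_deg b):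
     ... -> F_2 -> F_1 -> F_0 -> K -> 0. *)
Record graded_free_resolution (K : fieldType) (n : nat) := GradedFreeResolution {
  fr_basis : nat -> finType;
  fr_deg : forall i, fr_basis i -> nat;
  fr_diff : forall i, fr_basis i.+1 -> fr_basis i -> {mpoly K[n]};
  fr_aug : fr_basis 0%N -> K;
  fr_diff_homog : forall i (b : fr_basis i.+1) (c : fr_basis i),
    twist_homog (fr_deg c) (fr_deg b) (fr_diff b c);
  fr_aug_homog : forall b : fr_basis 0%N, fr_deg b != 0%N -> fr_aug b = 0;
  fr_aug_surj : forall a : K, exists v, @augment K n _ fr_aug v = a;
  fr_exact0 : forall v,
    augment fr_aug v = 0 <-> exists w, free_map (@fr_diff 0%N) w = v;
  fr_exactS : forall i v,
    free_map (@fr_diff i) v = 0 <-> exists w, free_map (@fr_diff i.+1) w = v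
}.

(* For an ideal I, F_i (x)_S I is the module of families in I indexed by the
   basis of F_i, with the differential given by the same matrix. *)
Section TorOfIdeal.
Variables (K : fieldType) (n : nat) (F : graded_free_resolution K n).
Variables (I : {mpoly K[n]} -> Prop).

Definition tensor_chain (i j : nat) (v : {ffun fr_basis F i -> {mpoly K[n]}}) :=
  forall b, I (v b) /\ twist_homog (fr_deg b) j (v b).

Definition is_closed (i : nat) : {ffun fr_basis F i -> {mpoly K[n]}} -> Prop :=
  match i with
  | 0%N => fun _ => True
  | i'.+1 => fun v => free_map (@fr_diff _ _ F i') v = 0
  end.

Definition tor_cycle (i j : nat) (v : {ffun fr_basis F i -> {mpoly K[n]}}) :=
  tensor_chain j v /\ is_closed v.

Definition tor_boundary (i j : nat) (v : {ffun fr_basis F i -> {mpoly K[n]}}) :=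
  exists2 w, @tensor_chain i.+1 j w & free_map (@fr_diff _ _ F i) w = v.

Definition tor_dim (i j r : nat) : Prop :=
  quotient_dim (@tor_cycle i j) (@tor_boundary i j) r.

End TorOfIdeal.

(* The Koszul complex, as the resolution of K with which Tor is computed. *)

Definition koszul_basis (n i : nat) : finType :=
  {F : {set 'I_n} | #|F| == i}.

Definition koszul_coef (K : fieldType) (n : nat) (F G : {set 'I_n}) :
    {mpoly K[n]} :=
  \sum_(x in F | F :\ x == G) (-1) ^+ #|[set y in F | (y < x)%N]| * 'X_x.

Section KoszulExact.
Variables (K : fieldType) (n : nat).
Implicit Types (f : {set 'I_n} -> {mpoly K[n]}) (F G : {set 'I_n}).
Implicit Types (x y t : 'I_n) (m : 'X_{1..n}) (p : {mpoly K[n]}).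

Let s x G : K := (-1) ^+ #|[set y in G | (y < x)%N]|.
Let sg x G : {mpoly K[n]} := (-1) ^+ #|[set y in G | (y < x)%N]|.
Let kosz f G := \sum_(x | x \notin G) f (x |: G) * (sg x G * 'X_x).

Let sgU x y G : y \notin G -> sg x (y |: G) = (-1) ^+ (y < x)%N * sg x G.
Proof.
move=> yG; rewrite /sg -exprD; congr (_ ^+ _).
case: ltnP => h.
  have -> : [set z in y |: G | (z < x)%N] = y |: [set z in G | (z < x)%N].
    by apply/setP=> z; rewrite !inE; case: eqVneq => // ->; rewrite h.
  by rewrite cardsU1 !inE (negbTE yG).
rewrite add0n; apply: eq_card => z; rewrite !inE.
by case: eqVneq => // ->; rewrite ltnNge h /= !andbF.
Qed.

Let sg_self x G : sg x (x |: G) = sg x G.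
Proof.
rewrite /sg; congr (_ ^+ _); apply: eq_card => z; rewrite !inE.
by case: eqVneq => // ->; rewrite ltnn !andbF.
Qed.

Let sum_antisym (a : 'I_n -> 'I_n -> {mpoly K[n]}) :
  (forall x, a x x = 0) -> (forall x y, a x y = - a y x) ->
  \sum_x \sum_y a x y = 0.
Proof.
move=> a0 aN.
have -> : \sum_x \sum_y a x y =
    \sum_(x : 'I_n) \sum_(y : 'I_n | (x < y)%N) a x y +
    \sum_(x : 'I_n) \sum_(y : 'I_n | (y < x)%N) a x y.
  rewrite -big_split; apply: eq_bigr => x _ /=.
  rewrite (bigID (fun y : 'I_n => (x < y)%N)) /=; congr (_ + _).
  rewrite (bigD1 x) /= ?ltnn // a0 add0r; apply: eq_bigl => y.
  by rewrite -leqNgt ltn_neqAle andbC.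
rewrite [X in _ + X](exchange_big_dep xpredT) //= -big_split big1 // => x _ /=.
by rewrite -big_split big1 // => y _ /=; rewrite aN addNr.
Qed.

Let kosz_kosz f G : kosz (kosz f) G = 0.
Proof.
pose a x y : {mpoly K[n]} := if [&& x \notin G, y \notin G & x != y] then
  f (y |: (x |: G)) * (sg y (x |: G) * 'X_y) * (sg x G * 'X_x) else 0.
have a0 x : a x x = 0 by rewrite /a eqxx !andbF.
have aN x y : a x y = - a y x.
  rewrite /a (eq_sym y x) [X in - (if X then _ else _)]andbCA.
  case: ifP => [/and3P[xG yG yx]|_]; last by rewrite oppr0.
  rewrite setUCA !sgU //.
  have -> : (-1) ^+ (x < y)%N = - (-1) ^+ (y < x)%N :> {mpoly K[n]}.
    by case: (ltngtP x y) yx => [_ _|_ _|/val_inj->];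
       rewrite ?eqxx ?expr0 ?expr1 ?opprK.
  by ring.
rewrite -[RHS](sum_antisym a0 aN).
rewrite /kosz big_mkcond; apply: eq_bigr => x _.
case: ifPn => xG; last by rewrite big1 // => y _; rewrite /a (negbTE xG).
rewrite mulr_suml big_mkcond; apply: eq_bigr => y _.
by rewrite /a xG !inE negb_or eq_sym andbC; case: ifP.
Qed.

Let mcoeff_sgM x G p m : (sg x G * p)@_m = s x G * p@_m.
Proof. by rewrite /sg /s -signr_odd -[in RHS]signr_odd; case: odd;
  rewrite ?expr1 ?expr0 ?mulN1r ?mul1r ?mcoeffN. Qed.

Let mcoeff_mulX p x m :
  (p * 'X_x)@_m = if (0 < m x)%N then p@_(m - U_(x))%MM else 0.
Proof.
case: ifPn => mx.
  by rewrite -{1}[m](@submK _ U_(x) m) ?lep1mP -?lt0n // [X in _@_X]addmC mcoeffMX.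
apply/eqP; rewrite mcoeff_eq0 (perm_mem (msuppMX _ _)).
apply/mapP => -[m' _ Em]; move: mx; rewrite Em mnmDE mnm1E eqxx.
by rewrite ?addn1 ?add1n.
Qed.

Let mcoeff_kosz f G m : (kosz f G)@_m =
  \sum_(x | (x \notin G) && (0 < m x)%N) s x G * (f (x |: G))@_(m - U_(x))%MM.
Proof.
rewrite /kosz raddf_sum /= big_mkcondr /=; apply: eq_bigr => x _.
by rewrite mulrCA mcoeff_sgM mcoeff_mulX; case: ifP; rewrite ?mulr0.
Qed.

(* Contracting homotopy: on monomials, m e_F is sent to (m / x_t) e_(t |: F)
   where t is the least index of a variable in m or F, if t is not in F. *)
Let low t m := [forall y : 'I_n, (y < t)%N ==> (m y == 0%N)].
Let hp t (p : {mpoly K[n]}) : {mpoly K[n]} :=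
  \sum_(m <- msupp p | (0 < m t)%N && low t (m - U_(t))%MM)
     p@_m *: 'X_[(m - U_(t))%MM].
Let least t G := (t \in G) && [forall y in G, (t <= y)%N].
Let hom f G := \sum_(t | least t G) hp t (f (G :\ t)).

Let mcoeff_hp t p m :
  (hp t p)@_m = if low t m then p@_(m + U_(t))%MM else 0.
Proof.
rewrite /hp raddf_sum /=.
under eq_bigr => k _ do rewrite mcoeffZ mcoeffX.
have E (k : 'X_{1..n}) : (0 < k t)%N -> ((k - U_(t))%MM == m) = (k == (m + U_(t))%MM).
  move=> kt; apply/eqP/eqP => [<-|->]; last by rewrite addmK.
  by rewrite submK ?lep1mP -?lt0n.
case: ifPn => lm; last first.
  rewrite big1 // => k /andP[_]; case: eqP => [->|_ _]; last by rewrite mulr0.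
  by rewrite (negbTE lm).
have [mp|mp] := boolP ((m + U_(t))%MM \in msupp p); last first.
  rewrite (memN_msupp_eq0 mp) big_seq_cond big1 // => k /and3P[kp kt _].
  by rewrite E //; case: eqP => [kE|]; [rewrite -kE kp in mp|rewrite mulr0].
rewrite big_mkcond (bigD1_seq (m + U_(t))%MM) //= addmK eqxx mulr1 lm.
rewrite mnmDE mnm1E eqxx addn1 /= big1 ?addr0 // => k kE.
by case: ifP => // /andP[kt _]; rewrite E // (negbTE kE) mulr0.
Qed.

Let hom_least f t G : least t G -> hom f G = hp t (f (G :\ t)).
Proof.
move=> tG; rewrite /hom (bigD1 t) //= big1 ?addr0 // => y /andP[yG /negP[]].
apply/eqP/val_inj/anti_leq; move: yG tG => /andP[yG /forall_inP hy].
by case/andP=> tG /forall_inP ht; rewrite hy // ht.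
Qed.

Let s_least t G x : t \notin G -> (t < x)%N -> s x (t |: G) = - s x G.
Proof.
move=> tG tx; rewrite /s.
have -> : [set z in t |: G | (z < x)%N] = t |: [set z in G | (z < x)%N].
  by apply/setP=> z; rewrite !inE; case: eqVneq => // ->; rewrite tx.
by rewrite cardsU1 !inE (negbTE tG) exprS mulN1r.
Qed.

Let s_le t G : (forall y, y \in G -> (t <= y)%N) -> s t G = 1.
Proof.
move=> h; rewrite /s; have -> : [set y in G | (y < t)%N] = set0.
  by apply/setP=> z; rewrite !inE; apply/negP => /andP[/h]; rewrite leqNgt => /negbTE->.
by rewrite cards0.
Qed.

Let mcoeff_homotopy f F m :
  (forall G, #|G|.+1 = #|F| -> kosz f G = 0) ->
  (#|F| == 0)%N ==> (m != 0%MM) ->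
  (kosz (hom f) F)@_m = (f F)@_m.
Proof.
move=> fz Fm.
pose A := [set x | (x \in F) || (0 < m x)%N].
have [x0 x0A] : exists x, x \in A.
  have [F0|] := eqVneq F set0; last first.
    by case/set0Pn => x xF; exists x; rewrite inE xF.
  move: Fm; rewrite F0 cards0 /= => m0.
  case: (pickP (fun x => 0 < m x)%N) => [x mx|m00].
    by exists x; rewrite inE mx orbT.
  case/eqP: m0; apply/mnmP => x; rewrite mnm0E; apply/eqP.
  by rewrite -leqn0 leqNgt m00.
case: (@arg_minnP _ x0 (fun z => z \in A) (fun x : 'I_n => x : nat) x0A) => t tA tmin.
have tminF y : y \in F -> (t <= y)%N by move=> yF; apply: tmin; rewrite inE yF.
have low_m m' : (forall y, (0 < m' y)%N -> (0 < m y)%N || (y == t)) -> low t m'.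
  move=> h; apply/forall_inP => y yt; rewrite -leqn0 leqNgt; apply/negP => /h.
  case/orP=> [my|/eqP yE]; last by rewrite yE ltnn in yt.
  by have := tmin y; rewrite inE my orbT leqNgt yt => /(_ isT).
rewrite mcoeff_kosz.
have [tF|tF] := boolP (t \in F); last first.
  have mt : (0 < m t)%N by move: tA; rewrite inE (negbTE tF).
  rewrite (bigD1 t) ?tF //= s_le // mul1r (@hom_least _ t); last first.
    rewrite /least setU11; apply/forall_inP => y /setU1P[->//|]; exact: tminF.
  rewrite setU1K // mcoeff_hp low_m; last first.
    by move=> y; rewrite mnmBE => h; rewrite (leq_trans h) ?leq_subr.
  rewrite submK ?lep1mP -?lt0n // big1 ?addr0 // => x /andP[/andP[xF mx] xt].
  case: (@arg_minnP _ x (fun z => z \in x |: F) (fun y : 'I_n => y : nat) (setU11 x F)) => u uA umin.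
  rewrite (@hom_least _ u); last by rewrite /least uA; apply/forall_inP.
  rewrite mcoeff_hp [low _ _](_ : _ = false) ?mulr0 //.
  apply/negP => /forallP/(_ t)/implyP; rewrite mnmBE mnm1E (negbTE xt) subn0.
  case: ltnP => [_ /(_ isT)/eqP m0|ut]; first by rewrite m0 in mt.
  move=> _; have tu : (t <= u)%N.
    move: uA => /setU1P[->|/tminF//]; apply: tmin.
    by rewrite inE mx orbT.
  have E : u = t by apply/val_inj/anti_leq; rewrite ut tu.
  by move: uA; rewrite E !inE (negbTE tF) eq_sym (negbTE xt).
have tx x : x \notin F -> (0 < m x)%N -> (t < x)%N.
  move=> xF mx; rewrite ltn_neqAle tmin ?inE ?mx ?orbT // andbT.
  by apply/negP => /eqP/val_inj E; rewrite -E tF in xF.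
have /fz/(congr1 (fun p => p@_(m + U_(t))%MM)) : #|F :\ t|.+1 = #|F|.
  by rewrite (cardsD1 t F) tF.
rewrite mcoeff_kosz mcoeff0 (bigD1 t) /=; last first.
  by rewrite !inE eqxx mnmDE mnm1E eqxx addn1.
rewrite addmK setD1K // s_le; last by move=> y /setD1P[_]; exact: tminF.
rewrite mul1r => /eqP; rewrite addr_eq0 => /eqP->; rewrite -sumrN.
apply: eq_big => [x|x /andP[xF mx]].
  rewrite !inE mnmDE mnm1E; case: (eqVneq x t) => [->|xt] /=.
    by rewrite tF andbF.
  by rewrite addn0 andbT.
rewrite -{1}(setD1K tF) s_least ?setD11 ?tx // mulNr; congr (- (_ * _)).
have xt : x != t by apply: contraNneq xF => ->.
rewrite (@hom_least _ t); last first.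
  rewrite /least setU1r //; apply/forall_inP => y /setU1P[->|]; last exact: tminF.
  by rewrite ltnW // tx.
rewrite mcoeff_hp low_m; last first.
  by move=> y; rewrite mnmBE => h; rewrite (leq_trans h) ?leq_subr.
congr mcoeff.
  by apply/mnmP => y; rewrite !(mnmBE, mnmDE) !mnm1E; case: (eqVneq x y) => [<-|];
     rewrite ?subn0 // addnBAC.
congr f; apply/setP => y; rewrite !inE.
by case: (eqVneq y x) => [->|//]; rewrite xt.
Qed.

Local Notation kdiff := (fun i (b : koszul_basis n i.+1) (c : koszul_basis n i) =>
  koszul_coef K (val b) (val c)).

Let kb i F (h : #|F| == i) : koszul_basis n i :=
  exist (fun F : {set 'I_n} => #|F| == i) F h.

Let ext i (v : {ffun koszul_basis n i -> {mpoly K[n]}}) F : {mpoly K[n]} :=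
  oapp v 0 (insub F).

Let extE i (v : {ffun koszul_basis n i -> {mpoly K[n]}}) b : ext v (val b) = v b.
Proof. by rewrite /ext valK. Qed.

Let ext0 i (v : {ffun koszul_basis n i -> {mpoly K[n]}}) F :
  #|F| != i -> ext v F = 0.
Proof. by move=> h; rewrite /ext insubN. Qed.

Let free_map_kosz i v (c : koszul_basis n i) :
  free_map (kdiff i) v c = kosz (ext v) (val c).
Proof.
rewrite ffunE /kosz /koszul_coef.
under eq_bigr => b _ do rewrite mulr_sumr.
rewrite (exchange_big_dep (fun x => x \notin val c)) /=; last first.
  by move=> b x _ /andP[_ /eqP<-]; rewrite setD11.
apply: eq_bigr => x xc.
have card_xc : #|x |: val c| == i.+1 by rewrite cardsU1 xc (eqP (valP c)).
rewrite (big_pred1 (kb card_xc)) => [|b].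
  by rewrite -(extE v) /= -/(sg x (x |: val c)) sg_self.
apply/andP/eqP => [[xb /eqP bc]|->].
  by apply: val_inj; rewrite -[LHS](setD1K xb); exact: congr1.
by rewrite setU11 setU1K.
Qed.

Let ext_free_map i v F : ext (free_map (kdiff i) v) F = kosz (ext v) F.
Proof.
have [Fi|Fi] := boolP (#|F| == i).
  by rewrite -[F]/(val (kb Fi)) extE free_map_kosz.
rewrite ext0 // /kosz big1 // => x xF.
by rewrite ext0 ?mul0r // cardsU1 xF add1n eqSS.
Qed.

Let ext_inj i (v w : {ffun koszul_basis n i -> {mpoly K[n]}}) :
  (forall F, #|F| = i -> ext v F = ext w F) -> v = w.
Proof. by move=> h; apply/ffunP => b; rewrite -!extE h // (eqP (valP b)). Qed.

Let homv i (v : {ffun koszul_basis n i -> {mpoly K[n]}}) :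
    {ffun koszul_basis n i.+1 -> {mpoly K[n]}} :=
  [ffun b => hom (ext v) (val b)].

Let kosz_ext_homv i (v : {ffun koszul_basis n i -> {mpoly K[n]}}) F :
  #|F| = i -> kosz (ext (homv v)) F = kosz (hom (ext v)) F.
Proof.
move=> Fi; apply: eq_bigr => x xF; congr (_ * _).
have card_xF : #|x |: F| == i.+1 by rewrite cardsU1 xF Fi.
rewrite -[x |: F]/(val (kb card_xF)).
by rewrite extE ffunE.
Qed.

Lemma koszul_exactS i v : free_map (kdiff i) v = 0 <->
  exists w, free_map (kdiff i.+1) w = v.
Proof.
split=> [v0|[w <-]]; last first.
  apply/ffunP => b; rewrite free_map_kosz [RHS]ffunE.
  rewrite -[RHS](kosz_kosz (ext w) (val b)).
  by apply: eq_bigr => x _; rewrite ext_free_map.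
exists (homv v); apply: ext_inj => F Fi; rewrite ext_free_map kosz_ext_homv //.
apply/mpolyP => m; apply: mcoeff_homotopy; last by rewrite Fi.
by move=> G; rewrite Fi => -[Gi]; rewrite -ext_free_map v0 /ext;
  case: insub => //= b; rewrite ffunE.
Qed.

Let aug0 (v : {ffun koszul_basis n 0 -> {mpoly K[n]}}) :
  augment (fun=> 1) v = (ext v set0)@_0.
Proof.
have c0 : #|set0 : {set 'I_n}| == 0%N by rewrite cards0.
rewrite /augment (big_pred1 (kb c0)) => [|b].
  by rewrite mulr1 -extE.
by apply/esym/eqP/val_inj/cards0_eq/eqP; exact: (valP b).
Qed.

Lemma koszul_exact0 (v : {ffun koszul_basis n 0 -> {mpoly K[n]}}) :
  augment (fun=> 1) v = 0 <-> exists w, free_map (kdiff 0%N) w = v.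
Proof.
rewrite aug0; split=> [v0|[w <-]]; last first.
  by rewrite ext_free_map mcoeff_kosz big1 // => x; rewrite mnm0E andbF.
exists (homv v); apply: ext_inj => F F0; rewrite ext_free_map kosz_ext_homv //.
apply/mpolyP => m; have [->|mn0] := eqVneq m 0%MM.
  rewrite (cards0_eq F0) v0 mcoeff_kosz big1 // => x.
  by rewrite mnm0E andbF.
by apply: mcoeff_homotopy => [G|]; rewrite ?F0.
Qed.

Lemma koszul_aug_surj (a : K) :
  exists v : {ffun koszul_basis n 0 -> {mpoly K[n]}}, augment (fun=> 1) v = a.
Proof.
exists [ffun=> a%:MP]; rewrite aug0.
have c0 : #|set0 : {set 'I_n}| == 0%N by rewrite cards0.
rewrite -[set0]/(val (kb c0)) extE ffunE.
by rewrite mcoeffC eqxx mulr1.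
Qed.

Lemma koszul_diff_homog i (b : koszul_basis n i.+1) (c : koszul_basis n i) :
  twist_homog i i.+1 (kdiff i b c).
Proof.
rewrite /twist_homog leqnSn subSnn; apply: rpred_sum => x _.
by rewrite -signr_odd rpredMsign dhomogX /= mdeg1.
Qed.

Definition koszul : graded_free_resolution K n :=
  @GradedFreeResolution K n (koszul_basis n) (fun i _ => i) kdiff (fun=> 1)
    koszul_diff_homog (fun _ ne0 => False_ind _ (negP ne0 (eqxx 0%N)))
    koszul_aug_surj koszul_exact0 koszul_exactS.

End KoszulExact.

(* dim_K Tor_i^S(K, I)_j = r.  Negative internal degrees j need not be
   considered: all modules involved live in nonnegative degrees. *)
Definition graded_betti (K : fieldType) (n : nat) (I : {mpoly K[n]} -> Prop)
    (i j r : nat) : Prop :=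
  tor_dim (koszul K n) I i j r.

Definition has_linear_resolution (K : fieldType) (n d : nat)
    (I : {mpoly K[n]} -> Prop) : Prop :=
  forall i j : nat, j != (i + d)%N -> graded_betti I i j 0.

Definition edge_ideal (K : fieldType) (n : nat) (A : {set {set 'I_n}}) :
    {mpoly K[n]} -> Prop :=
  fun p => exists q : {set 'I_n} -> {mpoly K[n]},
    p = \sum_(F in A) q F * \prod_(v in F) 'X_v.

Arguments edge_ideal K {n} A _.

Definition uniform_clutter (n d : nat) (C : {set {set 'I_n}}) : Prop :=
  (forall F, F \in C -> #|F| = d) /\ cover C = [set: 'I_n].

Definition clutter_compl (n d : nat) (C : {set {set 'I_n}}) : {set {set 'I_n}} :=
  [set F : {set 'I_n} | (#|F| == d) && (F \notin C)].

(* s is the number of circuits of some d-uniform clutter, on any finite vertex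
   set, whose complement has an edge ideal without linear resolution. *)
Definition nonlinear_size (K : fieldType) (d s : nat) : Prop :=
  exists (n : nat) (C : {set {set 'I_n}}),
    [/\ uniform_clutter d C, #|C| = s &
        ~ has_linear_resolution d (edge_ideal K (clutter_compl d C))].

(* Main.v *)
Require Import Defs.
From mathcomp Require Import all_boot all_order all_algebra.
From mathcomp Require Import zify ring.

(** Split the Koszul complex with coefficients in I = I(A) by multidegree M.
    In multidegree M the basis element e_F can only carry the monomial
    x^(M - F), so the strand is the space of functions c on sets F of variables
    dividing M such that x^(M - F) lies in I, with the differential
    (D c)(F) = \sum_x (+-) c (x |: F).  If some variable x divides M twice, then
    adding x to F or removing it does not affect membership of x^(M - F) in I,
    and the cone over x contracts the strand.  If M is the squarefree monomial on
    a vertex set W, replace F by G = W \ F: the strand becomes the relative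
    cochain complex of the full simplex on W modulo the clique complex of the
    clutter of nonedges (d-sets outside A).  The simplex is acyclic, so every
    cocycle c is D b0, and what remains is to correct b0 by a coboundary so that
    it vanishes on the faces of the clique complex of the relevant size s.  Linear
    resolution means that this can be done whenever s >= d.

    Such a correction exists as soon as the family of those faces has fewer than
    2 s members ([coboundary_on]).  Remove one face at a time.  If a face has a
    ridge contained in no other member, the value of the correction on this ridge
    adjusts the value on the face and nothing else.  Otherwise
    [small_family] finds a face whose ridges together with one further vertex
    span a simplex all of whose facets are in the family, and then the
    cocycle condition on this simplex determines the value on the face from the
    others.  The count in [small_family] is where 2 s appears: around a
    face there are 1 face (itself), s neighbours across its ridges, and, unless
    all neighbours share the same new vertex, p (s - p) >= s - 1 further faces
    at distance two, where 0 < p < s.  Finally, if there are fewer than 2 d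
    nonedges, then there are fewer than 2 s faces of every size s >= d
    ([faces_lt]).

    The bound is reached by the bipyramid over the boundary of a (d-1)-simplex:
    two apices, a base of d vertices, and as circuits the base minus one vertex
    plus one apex.  This is a (d-1)-sphere without cliques of size d + 1, and the
    indicator cochain of one of its facets yields a nonzero class in Tor_1 in
    degree d + 2. *)

Set Implicit Arguments.
Unset Strict Implicit.
Unset Printing Implicit Defensive.

Import GRing.Theory.
Local Open Scope nat_scope.

(** * Small families of sets of equal size *)

Section Combinatorics.
Variable n : nat.
Implicit Types (F G H N P Q W : {set 'I_n}) (x y u : 'I_n).
Implicit Types (B A : {set {set 'I_n}}).

Lemma pair_inj P Q p p' x x' : [disjoint P & Q] ->
    p \in P -> p' \in P -> x \in Q -> x' \in Q ->
  [set p; x] = [set p'; x'] -> p = p' /\ x = x'.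
Proof.
move=> /disjointFr PQ pP p'P xQ x'Q /setP E; split; apply/eqP.
  move: (E p); rewrite !inE eqxx /= => /esym/orP[//|/eqP px].
  by move: (PQ _ pP); rewrite px x'Q.
move: (E x); rewrite !inE eqxx orbT => /esym/orP[/eqP xp|//].
by move: (PQ _ p'P); rewrite -xp xQ.
Qed.

Lemma card_pairs P Q : [disjoint P & Q] ->
  #|[set [set p; x] | p in P, x in Q]| = (#|P| * #|Q|)%N.
Proof.
move=> PQ; rewrite curry_imset2X card_in_imset ?cardsX // => -[p x] [p' x'].
by rewrite !inE /= => /andP[pP xQ] /andP[p'P x'Q] /(pair_inj PQ)[]// -> ->.
Qed.

(** In terms of complements, W \ F' is a neighbour of W \ F across the ridge
    W \ (x |: F), and y is the vertex that replaces x. *)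
Lemma exchange F F' x : #|F'| = #|F| -> F' != F -> F' \subset x |: F ->
  [/\ x \notin F, x \in F' & exists2 y, y \in F & F' = x |: (F :\ y)].
Proof.
move=> cF nF sF.
have nsub : ~~ (F' \subset F).
  by apply: contra nF => s; rewrite eqEcard s cF leqnn.
have xF' : x \in F'.
  apply: contraR nsub => xF'; apply/subsetP => z zF'.
  by have /setU1P[zx|//] := subsetP sF z zF'; rewrite -zx zF' in xF'.
have xF : x \notin F.
  apply: contra nsub => xF; apply: subset_trans sF _.
  by rewrite subUset sub1set xF subxx.
split=> //.
have : 0 < #|F :\: F'|.
  rewrite lt0n cards_eq0 setD_eq0; apply: contra nF => s.
  by rewrite eq_sym eqEcard s cF leqnn.
case/card_gt0P => y; rewrite inE => /andP[yF' yF]; exists y => //.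
apply/eqP; rewrite eqEcard; apply/andP; split.
  apply/subsetP => z zF'; have /setU1P[->|zF] := subsetP sF z zF'.
    exact: setU11.
  by apply/setU1P; right; rewrite !inE zF andbT; apply: contraNneq yF' => <-.
have := cardsD1 y F; rewrite yF cardsU1 !inE (negbTE xF) andbF /= cF.
by move->; rewrite leqnn.
Qed.

(** Everything is read through complements in [W]: the family consists of the
    s-sets W \ F, enlarging F by x means passing to a ridge of W \ F, and the
    conclusion produces a simplex W \ (F :\ y) with all its facets in the family.
    For a fixed F in B, with a neighbour whose new vertex is y, the members F' are
    sorted by F' \ F.  If P, the set of x whose neighbour can be chosen
    with new vertex y, misses some x, then crossing two ridges, at p in P and
    x outside P, realizes every such pair as some F' \ F, and the values
    set0, [set x], [set p; x] amount to 1 + s + |P| (s - |P|) >= 2 s members. *)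
Lemma small_family W B k s : 0 < s -> B != set0 -> #|B| < 2 * s ->
    (forall F, F \in B -> [/\ F \subset W, #|F| = k & #|W :\: F| = s]) ->
    (forall F x, F \in B -> x \in W :\: F ->
       exists2 F', F' \in B & (F' != F) && (F' \subset x |: F)) ->
  exists F y, [/\ F \in B, y \in F &
    forall x, x \in W :\: F -> x |: (F :\ y) \in B].
Proof.
move=> s0 /set0Pn[F FB] cB BW ridge.
have [_ cF cWF] := BW F FB.
have ex F1 x : F1 \in B -> x \in W :\: F1 ->
    exists2 y, y \in F1 & x |: (F1 :\ y) \in B.
  move=> F1B xF1; have [F' F'B /andP[nF sF]] := ridge _ _ F1B xF1.
  have [_ c1 _] := BW _ F1B; have [_ c' _] := BW _ F'B.
  have [_ _ [y yF1 E]] := exchange (etrans c' (esym c1)) nF sF.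
  by exists y; rewrite // -E.
have /card_gt0P[a aF] : 0 < #|W :\: F| by rewrite cWF.
have [y yF ayB] := ex F a FB aF.
pose P := [set x in W :\: F | x |: (F :\ y) \in B].
have aP : a \in P by rewrite inE aF.
exists F, y; split=> // x xF; apply: contraTT cB => xyB; rewrite -leqNgt.
pose Q := (W :\: F) :\: P.
have xQ : x \in Q by rewrite !in_setD [x \in P]inE xF (negbTE xyB) -in_setD.
have PQ : [disjoint P & Q] by rewrite disjoint_sym disjoints_subset /Q setDE subsetIr.
have PW : P \subset W :\: F by apply/subsetP => z; rewrite inE => /andP[].
have cPQ : #|P| + #|Q| = s.
  by rewrite -cWF -(cardsID P (W :\: F)) (setIidPr PW).
pose D (F' : {set 'I_n}) := F' :\: F.
have notF z : z \in W :\: F -> z \notin F by rewrite inE => /andP[].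
have img0 : set0 \in D @: B.
  by apply/imsetP; exists F; rewrite // /D setDv.
have img1 z : z \in W :\: F -> [set z] \in D @: B.
  move=> zF; have [y' y'F zB] := ex F z FB zF; apply/imsetP; exists (z |: (F :\ y')) => //.
  apply/setP => t; rewrite /D !inE; case: (eqVneq t z) => [->|_] /=.
    by rewrite notF.
  by case: (t \in F); rewrite ?andbF.
(* Cross the ridge at p to reach p |: (F :\ y), then the ridge at z.  The vertex w
   given back is not p, since otherwise z would be in P. *)
have img2 p z : p \in P -> z \in Q -> [set p; z] \in D @: B.
  move=> pP; rewrite /Q in_setD => /andP[zP zW].
  move: (pP); rewrite inE => /andP[pW pB].
  have zp : z != p by apply: contraNneq zP => ->.
  have zWp : z \in W :\: (p |: (F :\ y)).
    move: zW; rewrite !inE => /andP[/negbTE-> ->].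
    by rewrite (negbTE zp) andbF.
  have [w wFp wB] := ex _ z pB zWp.
  apply/imsetP; exists (z |: ((p |: (F :\ y)) :\ w)) => //.
  have wp : w != p.
    apply: contraNneq zP => wp; rewrite inE zW /=.
    suff <- : (p |: F :\ y) :\ w = F :\ y by [].
    by rewrite wp setU1K // !inE (negbTE (notF _ pW)) andbF.
  apply/setP => t; rewrite /D !inE; case: (eqVneq t p) => [->|tp] /=.
    by rewrite notF // (eq_sym p w) wp orbT.
  case: (eqVneq t z) => [->|_] /=; first by rewrite notF.
  by case: (t \in F); rewrite ?andbF.
have sub : set0 |: ([set [set z] | z in W :\: F] :|:
    [set [set p; z] | p in P, z in Q]) \subset D @: B.
  apply/subsetP => S /setU1P[->//|/setUP[/imsetP[z zF ->]|]]; first exact: img1.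
  by case/imset2P => p z pP zQ ->; exact: img2.
have := leq_trans (subset_leq_card sub) (leq_imset_card _ _).
have dis : [set [set z] | z in W :\: F] :&: [set [set p; z] | p in P, z in Q] = set0.
  apply/setP => S; rewrite !inE; apply/negP => /andP[/imsetP[z _ ->]].
  case/imset2P => p t pP tQ /setP E; have /eqP pz : p == z.
    by have := E p; rewrite !inE eqxx.
  have /eqP tz : t == z by have := E t; rewrite !inE eqxx orbT.
  by have := disjointFr PQ pP; rewrite pz -tz tQ.
have no0 : set0 \notin [set [set z] | z in W :\: F] :|: [set [set p; z] | p in P, z in Q].
  apply/negP => /setUP[/imsetP[z _ /setP/(_ z)]|/imset2P[p z _ _ /setP/(_ p)]];
  by rewrite !inE eqxx.
rewrite cardsU1 no0 cardsU dis cards0 subn0 card_imset; last exact: set1_inj.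
rewrite card_pairs // cWF.
have P0 : 0 < #|P| by apply/card_gt0P; exists a.
have Q0 : 0 < #|Q| by apply/card_gt0P; exists x.
move=> /(leq_trans _); apply; move: #|P| #|Q| cPQ P0 Q0 => p q; clear; nia.
Qed.

(** For s > d there is at most one face: two distinct ones have together at least
    C(s, d) + C(s-1, d-1) >= (d + 1) + d subsets of size d. *)
Lemma faces_lt A d s : 0 < d -> d <= s -> #|A| < 2 * d ->
  #|[set G : {set 'I_n} | (#|G| == s) &&
     [forall N : {set 'I_n}, ((N \subset G) && (#|N| == d)) ==> (N \in A)]]| < 2 * s.
Proof.
move=> d0 ds cA; set Phi := [set G | _].
have PhiA G : G \in Phi -> [set N : {set 'I_n} | N \subset G & #|N| == d] \subset A.
  rewrite inE => /andP[_ /forallP GA]; apply/subsetP => N; rewrite inE => h.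
  exact: (implyP (GA N) h).
have PhiC G : G \in Phi -> #|G| = s by rewrite inE => /andP[/eqP].
case: (leqP #|Phi| 1) => [c1|]; first by apply: leq_ltn_trans c1 _; lia.
move/card_gt1P => [G [G' [GP G'P GG']]].
have [Es|lt_ds] : d = s \/ d < s by lia.
  apply: leq_ltn_trans (_ : #|A| < _); last by rewrite -Es.
  apply/subset_leq_card/subsetP => H HP; apply: (subsetP (PhiA _ HP)).
  by rewrite inE subxx (PhiC _ HP) Es eqxx.
have := cA; rewrite ltnNge => /negP[].
have cI : #|G :&: G'| <= s.-1.
  suff : #|G :&: G'| < s by lia.
  rewrite -(PhiC _ GP) proper_card // properEneq subsetIl andbT.
  apply: contra GG' => /eqP/setIidPl GsG'.
  by rewrite eqEcard GsG' (PhiC _ GP) (PhiC _ G'P) leqnn.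
have := subset_leq_card (_ : [set N : {set 'I_n} | N \subset G & #|N| == d] :|:
  [set N : {set 'I_n} | N \subset G' & #|N| == d] \subset A).
rewrite subUset !PhiA // => /(_ isT).
rewrite cardsU.
have -> : [set N : {set 'I_n} | N \subset G & #|N| == d] :&:
  [set N : {set 'I_n} | N \subset G' & #|N| == d] =
  [set N : {set 'I_n} | N \subset G :&: G' & #|N| == d].
  by apply/setP => N; rewrite !inE subsetI; case: (#|N| == d); rewrite ?andbT ?andbF.
rewrite !cards_draws (PhiC _ GP) (PhiC _ G'P).
have h1 : d.+1 <= 'C(s, d) by rewrite -{1}binSn leq_bin2l.
have h2 := leq_bin2l d cI.
have h3 : d <= 'C(s.-1, d.-1).
  have {1}-> : d = 'C(d, d.-1) by case: (d) d0 => // e _; rewrite binSn.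
  by apply: leq_bin2l; lia.
have h4 : 'C(s, d) = ('C(s.-1, d) + 'C(s.-1, d.-1))%N.
  by case: (s) lt_ds => [|s'] //; case: (d) d0 => // e _ _; rewrite binS.
move=> /(leq_trans _); apply; move: h1 h2 h3 h4.
move: (binomial s d) (binomial _ d) (binomial s.-1 d) (binomial _ _) => p q r t; clear; lia.
Qed.

End Combinatorics.

(** * One multidegree of the Koszul complex *)

Section KoszulStrand.
Variables (K : fieldType) (n : nat).
Implicit Types (F G H N P Q W : {set 'I_n}) (x y u : 'I_n).
Implicit Types (B A : {set {set 'I_n}}) (c b a : {set 'I_n} -> K).
Local Open Scope ring_scope.

Definition sgn x F : K := (-1) ^+ #|[set y in F | (y < x)%N]|.

(** The Koszul differential in a multidegree M with support [W]; [c F] is the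
    coefficient of x^(M - F) e_F. *)
Definition strand W c F : K := \sum_(x in W :\: F) sgn x F * c (x |: F).

(** Exterior multiplication by e_u, the contracting homotopy of the simplex. *)
Definition cone u c F : K := if u \in F then sgn u F * c (F :\ u) else 0.

Lemma sgnU x y F : y \notin F -> sgn x (y |: F) = (-1) ^+ (y < x)%N * sgn x F.
Proof.
move=> yF; rewrite /sgn -exprD; congr (_ ^+ _).
have -> : [set z in y |: F | (z < x)%N] =
    (if (y < x)%N then y |: [set z in F | (z < x)%N] else [set z in F | (z < x)%N]).
  apply/setP => z; case: ifP => yx; rewrite !inE;
  by case: eqVneq => // ->; rewrite yx ?andbF.
by case: ifP => // _; rewrite cardsU1 !inE (negbTE yF).
Qed.

(** The only sign rule behind D o D = 0 and the homotopy formula. *)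
Lemma sgn_swap x y F : x != y -> x \notin F -> y \notin F ->
  sgn x F * sgn y (x |: F) = - (sgn y F * sgn x (y |: F)).
Proof.
move=> xy xF yF; rewrite !sgnU //.
have -> : (-1) ^+ (y < x)%N = - (-1) ^+ (x < y)%N :> K.
  by case: (ltngtP x y) xy => [_ _|_ _|/val_inj->];
     rewrite ?eqxx ?expr0 ?expr1 ?opprK.
by ring.
Qed.

Lemma sgn_self x F : sgn x (x |: F) = sgn x F.
Proof.
rewrite /sgn; congr (_ ^+ _); apply: eq_card => z; rewrite !inE.
by case: eqVneq => // ->; rewrite ltnn !andbF.
Qed.

Lemma sgnK x F : sgn x F * sgn x F = 1.
Proof. by rewrite /sgn -expr2 sqrr_sign. Qed.

Lemma strandB W b c F : strand W (fun G => b G - c G) F = strand W b F - strand W c F.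
Proof. by rewrite /strand -sumrB; apply: eq_bigr => x _; rewrite mulrBr. Qed.

Lemma strand_strand W c F : strand W (strand W c) F = 0.
Proof.
(* The double sum is antisymmetric; splitting it along x < y and y < x avoids
   dividing by 2. *)
pose t x y := sgn x F * (sgn y (x |: F) * c (y |: (x |: F))).
pose D := W :\: F.
have -> : strand W (strand W c) F =
    \sum_(x in D) \sum_(y in D | (x < y)%N) t x y +
    \sum_(x in D) \sum_(y in D | (y < x)%N) t x y.
  rewrite -big_split; apply: eq_bigr => x xD /=.
  rewrite /strand mulr_sumr (bigID (fun y : 'I_n => (x < y)%N)) /=.
  congr (_ + _); apply: eq_bigl => y; rewrite !inE negb_or.
    by case: ltngtP => [xy||]; rewrite ?andbF // !andbT; case: eqVneq xy => // ->;
      rewrite ltnn.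
  rewrite -leqNgt ltn_neqAle -val_eqE /=.
  by case: eqVneq; rewrite ?andbF //= andbA.
rewrite [X in _ + X](exchange_big_dep (mem D)) /=; last by move=> x y _ /andP[].
apply/eqP; rewrite addr_eq0 -sumrN; apply/eqP; apply: eq_bigr => x xD.
rewrite -sumrN; apply: eq_big => [y|y /andP[yD xy]]; first by rewrite xD.
move: xD yD; rewrite !inE => /andP[xF _] /andP[yF _].
rewrite /t !mulrA sgn_swap ?mulNr 1?(setUCA [set y]) //.
by apply: contraTneq xy => ->; rewrite ltnn.
Qed.

Lemma strand_cone W u c F : u \in W ->
  strand W (cone u c) F = c F - cone u (strand W c) F.
Proof.
move=> uW; rewrite /strand /cone; case: ifPn => uF; last first.
  rewrite (bigD1 u) /=; last by rewrite inE uF.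
  rewrite setU11 setU1K // sgn_self mulrA sgnK mul1r subr0.
  rewrite big1 ?addr0 // => x /andP[_ xu].
  by rewrite !inE (eq_sym u) (negbTE xu) (negbTE uF) mulr0.
have uG : u \notin F :\ u by rewrite setD11.
move: (F :\ u) uG (setD1K uF) => G uG <- {uF}.
rewrite (bigD1 u (P := mem (W :\: G))) /=; last by rewrite inE uG.
rewrite mulrDr mulrA sgn_self sgnK mul1r opprD addrA subrr sub0r.
rewrite mulr_sumr -sumrN; apply: eq_big => [x|x].
  by rewrite !inE negb_or; case: (x == u); rewrite ?andbF ?andbT.
rewrite !inE negb_or => /andP[/andP[xu xG] xW].
have uxG : u \notin x |: G by rewrite !inE negb_or eq_sym xu.
rewrite eqxx orbT setUCA setU1K // !sgn_self !mulrA -mulNr; congr (_ * _).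
have E := sgn_swap xu xG uG; have p1 := sgnK x G; have X1 := sgnK x (u |: G).
by rewrite -[LHS]mul1r -p1 mulrACA E -[RHS]mulr1 -X1; ring.
Qed.

Definition indicator F0 (k : K) F : K := if F == F0 then k else 0.

(** Induction on [B].  A face with a free ridge can be treated last, because the
    value on that ridge affects no other face.  When no ridge is free, the simplex
    given by [small_family] makes the equation at one of its facets follow from
    the equations at the others and from D o D = 0. *)
Lemma coboundary_on W B k s b : (0 < s)%N -> (#|B| < 2 * s)%N ->
    (forall F, F \in B -> [/\ F \subset W, #|F| = k & #|W :\: F| = s]) ->
    (forall H, H \subset W -> #|H|.+1 = k ->
       (forall x, x \in W :\: H -> x |: H \in B) -> strand W b H = 0) ->
  exists a, forall F, F \in B -> strand W a F = b F.
Proof.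
move=> s0; move: {2}#|B| (leqnn #|B|) => m.
elim: m B => [|m IH] B cBm cB BW cocycle.
  exists (fun=> 0) => F; suff -> : B = set0 by rewrite inE.
  by apply/eqP; rewrite -cards_eq0 -leqn0.
have [->|B0] := eqVneq B set0; first by exists (fun=> 0) => F; rewrite inE.
have IH1 F : F \in B -> exists a, forall F', F' \in B -> F' != F -> strand W a F' = b F'.
  move=> FB; have cBF := cardsD1 F B; rewrite FB in cBF.
  have [||F'|H HW kH hB|a ha] := IH (B :\ F).
  - by move: cBm; rewrite cBF.
  - by apply: leq_ltn_trans cB; rewrite cBF leq_addl.
  - by case/setD1P => _; exact: BW.
  - by apply: cocycle => // x /hB/setD1P[].
  by exists a => F' F'B nF; apply: ha; rewrite !inE nF.
case: (boolP [forall F in B, forall x in W :\: F, exists F' in B,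
    (F' != F) && (F' \subset x |: F)]) => [/forall_inP ridge|].
  have [|F [y [FB yF hB]]] := @small_family n W B k s s0 B0 cB BW.
    move=> F x FB xF; have /forall_inP/(_ x xF)/exists_inP[F' F'B h] := ridge F FB.
    by exists F'.
  have [a ha] := IH1 F FB; exists a => F' F'B.
  have [->|/(ha _ F'B)//] := eqVneq F' F.
  have [FW cF _] := BW F FB.
  have yH : y \notin F :\ y by rewrite setD11.
  have EF := setD1K yF.
  have cH : #|F :\ y|.+1 = k by rewrite -cF (cardsD1 y F) yF.
  move: (F :\ y) yH EF hB cH => H yH EF hB cH.
  have HW : H \subset W by apply: subset_trans FW; rewrite -EF subsetUr.
  have hB' x : x \in W :\: H -> x |: H \in B.
    have [->|xy] := eqVneq x y; first by rewrite EF.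
    by move=> xH; apply: hB; move: xH; rewrite -EF !inE negb_or xy.
  have : strand W (fun G => b G - strand W a G) H = 0.
    by rewrite strandB cocycle // strand_strand subrr.
  rewrite [LHS](bigD1 y) /=; last by rewrite inE yH (subsetP FW).
  rewrite big1; last first.
    move=> x /andP[xH xy]; rewrite ha ?subrr ?mulr0 ?hB' //.
    apply: contraNneq xy => /setP/(_ x); rewrite -EF !inE eqxx /=.
    by case: (x == y) => //= E; move: xH; rewrite inE -E.
  rewrite addr0 EF => /(congr1 (fun z => sgn y H * z)).
  by rewrite mulrA sgnK mul1r mulr0 => /eqP; rewrite subr_eq0 => /eqP.
case/forall_inPn => F FB /forall_inPn[x xF] /exists_inPn free.
have [a ha] := IH1 F FB.
(* The ridge x |: F is free: changing the value of a there affects only F. *)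
pose e := sgn x F * (b F - strand W a F).
exists (fun G => a G - indicator (x |: F) (- e) G) => F' F'B; rewrite strandB.
have [->|nF] := eqVneq F' F; last first.
  rewrite ha // [X in _ - X]big1 ?subr0 // => z zF'; rewrite /indicator.
  case: eqP => [E|_]; last by rewrite mulr0.
  by have := free F' F'B; rewrite nF -E subsetUr.
rewrite [X in _ - X](bigD1 x) //= /indicator eqxx big1; last first.
  move=> z /andP[zF zx]; case: eqP => [/setP/(_ z)|_]; last by rewrite mulr0.
  by move: zF; rewrite !inE eqxx (negbTE zx) /= => /andP[/negbTE->].
by rewrite addr0 mulrN opprK mulrA sgnK mul1r addrC subrK.
Qed.

End KoszulStrand.

(** * Squarefree exponents and edge ideals *)

Section Monomials.
Variables (n : nat).
Implicit Types (F G H N W : {set 'I_n}) (x y u : 'I_n) (m M : 'X_{1..n}).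
Implicit Types (A : {set {set 'I_n}}).

Definition mset F : 'X_{1..n} := [multinom (x \in F : nat) | x < n].

Definition msupport m : {set 'I_n} := [set x | 0 < m x].

(** Membership of x^m in the edge ideal of [A]. *)
Definition edge_monomial A m := [exists G in A, G \subset msupport m].

Lemma msetE F x : mset F x = (x \in F). Proof. by rewrite mnmE. Qed.

Lemma mdeg_mset F : mdeg (mset F) = #|F|.
Proof.
rewrite mdegE; under eq_bigr => x _ do rewrite msetE.
by rewrite -sum1_card [RHS]big_mkcond /=; apply: eq_bigr => x _; case: (x \in F).
Qed.

Lemma mset_le F M : (mset F <= M)%MM = (F \subset msupport M).
Proof.
apply/mnm_lepP/subsetP => h x; first by move=> xF; move: (h x); rewrite msetE xF inE.
by rewrite msetE; case: (boolP (x \in F)) => // /h; rewrite inE.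
Qed.

Lemma mset_leD F m : F \subset msupport (m + mset F)%MM.
Proof. by rewrite -mset_le lem_addl. Qed.

Lemma msetU1 x F : x \notin F -> mset (x |: F) = (mset F + U_(x))%MM.
Proof.
move=> xF; apply/mnmP => y; rewrite mnmDE !msetE mnm1E !inE.
by case: (eqVneq y x) => [->|_]; rewrite ?(negbTE xF) ?addn0.
Qed.

Lemma msupport_mset F : msupport (mset F) = F.
Proof. by apply/setP => x; rewrite inE msetE; case: (x \in F). Qed.

Lemma card_msupport m : #|msupport m| <= mdeg m.
Proof. by rewrite -mdeg_mset; apply/lemc_mdeg/lem_leo; rewrite mset_le. Qed.

Lemma msupport_sub M F : (forall x, M x <= 1) ->
  msupport (M - mset F)%MM = msupport M :\: F.
Proof.
move=> M1; apply/setP => x; rewrite !inE mnmBE msetE.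
by case: (x \in F); rewrite ?subn0 //= subn_gt0 ltnNge M1.
Qed.

Lemma edge_monomialP A m : reflect (exists2 G, G \in A & G \subset msupport m) (edge_monomial A m).
Proof. exact: exists_inP. Qed.

End Monomials.

Section EdgeIdeals.
Variables (K : fieldType) (n : nat).
Implicit Types (A : {set {set 'I_n}}) (m : 'X_{1..n}) (p : {mpoly K[n]}).
Local Open Scope ring_scope.

Lemma prod_mset (F : {set 'I_n}) : \prod_(x in F) 'X_x = 'X_[mset F] :> {mpoly K[n]}.
Proof.
rewrite mprodXE; congr 'X_[_]; apply/mnmP => y; rewrite mnm_sumE msetE.
under eq_bigr => x _ do rewrite mnm1E.
have [yF|yF] := boolP (y \in F).
  by rewrite (bigD1 y) //= eqxx big1 // => x /andP[_ /negbTE->].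
by rewrite big1 // => x xF; case: eqP => // xy; rewrite -xy xF in yF.
Qed.

Lemma edge_ideal0 A : edge_ideal K A 0.
Proof. by exists (fun=> 0); rewrite big1 // => F _; rewrite mul0r. Qed.

Lemma edge_idealD A p q : edge_ideal K A p -> edge_ideal K A q -> edge_ideal K A (p + q).
Proof.
move=> [f ->] [g ->]; exists (fun F => f F + g F).
by rewrite -big_split; apply: eq_bigr => F _; rewrite mulrDl.
Qed.

Lemma edge_idealP A p :
  edge_ideal K A p <-> (forall m, p@_m != 0 -> edge_monomial A m).
Proof.
split=> [[q ->] m|h].
  rewrite raddf_sum /= => /eqP ne; apply/edge_monomialP.
  case: (pickP (fun G => (G \in A) && (G \subset msupport m))) => [G /andP[GA Gm]|no].
    by exists G.
  case: ne; rewrite big1 // => G GA; apply/eqP; rewrite mcoeff_eq0 prod_mset.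
  rewrite (perm_mem (msuppMX _ _)); apply/mapP => -[m' _ E].
  by have := no G; rewrite GA E addmC mset_leD.
rewrite (mpolyE p) big_seq; apply: (big_ind (edge_ideal K A)).
- exact: edge_ideal0.
- by move=> ? ?; exact: edge_idealD.
move=> m; rewrite mcoeff_msupp => /h/edge_monomialP[G GA Gm].
exists (fun H => if H == G then p@_m *: 'X_[m - mset G] else 0).
rewrite (bigD1 G) //= eqxx [X in _ + X]big1 => [|H /andP[_ /negbTE->]]; last by rewrite mul0r.
by rewrite prod_mset addr0 -scalerAl -mpolyXD submK // mset_le.
Qed.

End EdgeIdeals.

(** * Exactness in one multidegree *)

Section StrandExact.
Variables (K : fieldType) (n : nat).
Implicit Types (A : {set {set 'I_n}}) (m M : 'X_{1..n}) (c : {set 'I_n} -> K).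
Implicit Types (F G H N : {set 'I_n}).

(** If u divides M twice, the cone over u does not leave the ideal and contracts
    the strand.  If M is squarefree, the cone over any vertex gives a primitive on
    the full simplex, and [coboundary_on] makes it vanish on the set [B] of the F
    of size i + 1 with x^(M - F) outside the ideal. *)
Lemma strand_exact A d i M c : 0 < d -> (forall F, F \in A -> #|F| = d) ->
    #|clutter_compl d A| < 2 * d -> i + d < mdeg M ->
    (forall F, c F != 0%R ->
       [/\ F \subset msupport M, #|F| = i & edge_monomial A (M - mset F)%MM]) ->
    (forall F, strand (msupport M) c F = 0%R) ->
  exists b : {set 'I_n} -> K,
    (forall F : {set 'I_n}, F \subset msupport M -> #|F| = i.+1 -> b F != 0%R ->
       edge_monomial A (M - mset F)%MM) /\
    (forall F, strand (msupport M) b F = c F).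
Proof.
move=> d0 Ad cA dM c_supp c_closed; pose W := msupport M.
have cone_prim u : u \in W -> forall F, strand W (cone u c) F = c F.
  move=> uW F; rewrite strand_cone // /cone; case: ifP => _; last by rewrite subr0.
  by rewrite c_closed mulr0 subr0.
case: (boolP [exists u, 1 < M u]) => [/existsP[u Mu]|/existsPn sqf].
  have uW : u \in W by rewrite inE ltnW.
  exists (cone u c); split=> [F FM _|]; last exact: cone_prim.
  rewrite /cone; case: ifP => [uF|]; last by rewrite eqxx.
  rewrite mulf_eq0 negb_or => /andP[_ /c_supp[_ _ /edge_monomialP[G GA GM]]].
  apply/edge_monomialP; exists G => //; apply: subset_trans GM _.
  apply/subsetP => x; rewrite !inE !mnmBE !msetE !inE; case: eqP => // -> _.
  by rewrite uF subn_gt0.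
have M1 x : M x <= 1 by rewrite leqNgt sqf.
have EM : M = mset W.
  by apply/mnmP => x; rewrite msetE inE; case: (M x) (M1 x) => [|[]].
have cW : i + d < #|W| by rewrite -mdeg_mset -EM.
have /card_gt0P[u uW] : 0 < #|W| by apply: leq_ltn_trans cW.
pose B := [set F : {set 'I_n} | [&& F \subset W, #|F| == i.+1 &
  ~~ edge_monomial A (M - mset F)%MM]].
pose s := #|W| - i.+1.
have ds : d <= s by rewrite /s; lia.
have BW F : F \in B -> [/\ F \subset W, #|F| = i.+1 & #|W :\: F| = s].
  rewrite inE => /and3P[FW /eqP cF _]; split=> //.
  by rewrite cardsD (setIidPr FW) cF.
have WK F : F \subset W -> W :\: (W :\: F) = F.
  by move=> FW; rewrite setDDr setDv set0U (setIidPr FW).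
have cB : #|B| < 2 * s.
  have <- : #|(fun F => W :\: F) @: B| = #|B|.
    apply: card_in_imset => F F' /BW[FW _ _] /BW[F'W _ _] E.
    by rewrite -(WK F FW) E WK.
  apply: leq_ltn_trans (faces_lt d0 ds cA); apply/subset_leq_card/subsetP => G.
  case/imsetP => F FB ->; have [FW _ cF] := BW F FB; rewrite inE cF eqxx /=.
  apply/forallP => N; apply/implyP => /andP[NF cN]; rewrite inE cN /=.
  move: FB; rewrite inE => /and3P[_ _]; apply: contra => NA; apply/edge_monomialP.
  by exists N; rewrite // msupport_sub.
have [|a ha] := coboundary_on (leq_trans d0 ds) cB BW (b := cone u c).
  (* A simplex with all facets in the clique complex is a clique: it has more
     than d vertices, so a generator inside it would miss one of them. *)
  move=> H HW [cH] HB; rewrite cone_prim //.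
  apply/eqP; apply/negP => /negP/c_supp[_ _ /edge_monomialP[N NA]].
  rewrite msupport_sub // => NH.
  have : 0 < #|(W :\: H) :\: N|.
    rewrite cardsD (setIidPr NH) (Ad _ NA) cardsD (setIidPr HW) cH; lia.
  case/card_gt0P => x; rewrite inE => /andP[xN xH].
  have := HB x xH; rewrite inE => /and3P[_ _ /negP[]]; apply/edge_monomialP; exists N => //.
  rewrite msupport_sub // setUC -setDDl subsetD1 xN andbT.
  exact: NH.
exists (fun F => cone u c F - strand W a F)%R; split=> F; last first.
  by rewrite strandB strand_strand subr0 cone_prim.
move=> FW cF; apply: contraNT => FN; rewrite ha ?subrr // inE FW cF eqxx.
exact: FN.
Qed.

End StrandExact.

(** * From multidegrees to Betti numbers *)

Section KoszulComplex.
Variables (K : fieldType) (n : nat).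
Implicit Types (F G H W : {set 'I_n}) (x : 'I_n) (m M : 'X_{1..n}).
Implicit Types (f : {set 'I_n} -> {mpoly K[n]}) (p : {mpoly K[n]}).
Local Open Scope ring_scope.

(** Extension by zero, so that chains in different homological degrees can be
    handled as functions on all sets of variables. *)
Definition extend i (v : {ffun koszul_basis n i -> {mpoly K[n]}}) F : {mpoly K[n]} :=
  oapp v 0 (insub F).

Definition kosz f G : {mpoly K[n]} :=
  \sum_(x | x \notin G) sgn K x G *: (f (x |: G) * 'X_x).

(** The component of multidegree M: e_F carries the monomial x^(M - F). *)
Definition mgrade f M F : K :=
  if F \subset msupport M then (f F)@_(M - mset F)%MM else 0.

Lemma extendE i (v : {ffun koszul_basis n i -> {mpoly K[n]}}) b :
  extend v (val b) = v b.
Proof. by rewrite /extend valK. Qed.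

Lemma extend_out i (v : {ffun koszul_basis n i -> {mpoly K[n]}}) F :
  #|F| != i -> extend v F = 0.
Proof. by move=> h; rewrite /extend insubN. Qed.

Lemma mgrade_kosz f M G : G \subset msupport M ->
  mgrade (kosz f) M G = strand (msupport M) (mgrade f M) G.
Proof.
move=> GM; rewrite {1}/mgrade GM /kosz raddf_sum /= /strand.
rewrite (bigID (fun x => x \in msupport M)) /= [X in _ + X]big1 ?addr0.
  apply: eq_big => [x|x /andP[xG xM]]; first by rewrite in_setD.
  rewrite mcoeffZ /mgrade subUset sub1set xM GM /=; congr (_ * _).
  have -> : (M - mset G)%MM = (U_(x) + (M - mset (x |: G)))%MM.
    rewrite msetU1 // -submDA [RHS]addmC submK //; apply/mnm_lepP => y.
    rewrite mnm1E mnmBE msetE; case: eqP => // <-.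
    by rewrite (negbTE xG) subn0; move: xM; rewrite inE.
  by rewrite mcoeffMX.
move=> x /andP[xG xM]; rewrite mcoeffZ; apply/eqP; rewrite mulf_eq0 orbC.
rewrite mcoeff_eq0 (perm_mem (msuppMX _ _)); apply/orP; left.
apply/mapP => -[m _ /mnmP/(_ x)]; rewrite mnmBE mnmDE mnm1E eqxx.
by move: xM; rewrite inE -leqNgt leqn0 => /eqP->.
Qed.

Lemma free_map_kosz i (v : {ffun koszul_basis n i.+1 -> {mpoly K[n]}})
    (c : koszul_basis n i) :
  free_map (@fr_diff _ _ (koszul K n) i) v c = kosz (extend v) (val c).
Proof.
rewrite ffunE /= /kosz /koszul_coef.
under eq_bigr => b _ do rewrite mulr_sumr.
rewrite (exchange_big_dep (fun x => x \notin val c)) /=; last first.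
  by move=> b x _ /andP[_ /eqP<-]; rewrite setD11.
apply: eq_bigr => x xc.
have card_xc : #|x |: val c| == i.+1 by rewrite cardsU1 xc (eqP (valP c)).
rewrite (big_pred1 (exist (fun F : {set 'I_n} => #|F| == i.+1) _ card_xc)) => [|b].
  rewrite -extendE /= -[sgn K x _]sgn_self /sgn -signr_odd -[in RHS]signr_odd.
  by case: odd; rewrite ?expr1 ?expr0 ?mulN1r ?mul1r ?mulrN ?scaleN1r ?scale1r.
apply/andP/eqP => [[xb /eqP bc]|->].
  by apply: val_inj; rewrite -[LHS](setD1K xb) /= bc.
by rewrite setU11 setU1K.
Qed.

Lemma extend_free_map i (v : {ffun koszul_basis n i.+1 -> {mpoly K[n]}}) G :
  extend (free_map (@fr_diff _ _ (koszul K n) i) v) G = kosz (extend v) G.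
Proof.
have [Gi|Gi] := boolP (#|G| == i).
  by rewrite -[G]/(val (exist (fun F : {set 'I_n} => #|F| == i) _ Gi)) extendE free_map_kosz.
rewrite extend_out // /kosz big1 // => x xF.
by rewrite extend_out ?mul0r ?scaler0 // cardsU1 xF add1n eqSS.
Qed.

Lemma closed_kosz i (z : {ffun koszul_basis n i -> {mpoly K[n]}}) G :
  @is_closed _ _ (koszul K n) i z -> kosz (extend z) G = 0.
Proof.
case: i z => [|i] z zcl; last by rewrite -extend_free_map zcl /extend;
  case: insub => //= b; rewrite ffunE.
by rewrite /kosz big1 // => x xG; rewrite extend_out ?mul0r ?scaler0 // cardsU1 xG.
Qed.

Lemma mcoeff_bounded k (E : 'X_{1..n} -> K) m :
  (\sum_(m' : 'X_{1..n < k}) E m' *: 'X_[m'])@_m = if (mdeg m < k)%N then E m else 0.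
Proof.
case: ifP => mk; first exact: mcoeff_mpoly.
rewrite raddf_sum /= big1 // => m' _; rewrite mcoeffZ mcoeffX.
by case: eqP => [E'|_]; [rewrite -E' bmdeg in mk | rewrite mulr0].
Qed.

Lemma twist_homogE a j p : (a <= j)%N ->
  (forall m, p@_m != 0 -> mdeg m = (j - a)%N) -> twist_homog a j p.
Proof.
move=> aj h; rewrite /twist_homog aj; apply/dhomogP => m.
by rewrite mcoeff_msupp => /h.
Qed.

Lemma twist_homog_deg a j p m : twist_homog a j p -> p@_m != 0 ->
  (mdeg m + a)%N = j.
Proof.
rewrite /twist_homog; case: ifP => [aj /dhomogP h pm|_ /eqP->].
  by rewrite (h m) ?mcoeff_msupp // subnK.
by rewrite mcoeff0 eqxx.
Qed.

(** Only finitely many exponents have degree j, so no choice axiom is involved. *)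
Lemma finite_choice j (P : 'X_{1..n} -> ({set 'I_n} -> K) -> Prop) :
  (forall M, mdeg M = j -> exists b, P M b) ->
  exists b, forall M, mdeg M = j -> P M (b M).
Proof.
move=> ex; have [|b hb] := @fin_all_exists 'X_{1..n < j.+1} (fun=> {set 'I_n} -> K)
   (fun (M' : 'X_{1..n < j.+1}) b => mdeg M' = j -> P M' b).
  move=> M; case: (eqVneq (mdeg M) j) => [/ex[b Pb]|/eqP ne]; first by exists b.
  by exists (fun=> 0).
exists (fun M => oapp b (fun=> 0) (insub M)) => M Mj.
have Mj' : (mdeg M < j.+1)%N by rewrite Mj.
by rewrite insubT; exact: (hb (BMultinom Mj') Mj).
Qed.

(** Below degree i + d the chains themselves vanish, because every monomial of
    the ideal has degree at least d.  Above it, the primitives found in each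
    multidegree are reassembled: the coefficient of x^m in w F is the value at
    F of the primitive in multidegree m + F. *)
Theorem few_nonedges_linear (d : nat) (A : {set {set 'I_n}}) : (0 < d)%N ->
    (forall F, F \in A -> #|F| = d) -> (#|clutter_compl d A| < 2 * d)%N ->
  has_linear_resolution d (edge_ideal K A).
Proof.
move=> d0 Ad cA i j ji; exists (fun=> 0); split=> [[]|? _ []|z [chain zcl]] //.
exists (fun=> 0); rewrite big_ord0 subr0.
have zA b m : (z b)@_m != 0 -> edge_monomial A m.
  by have [/edge_idealP h _] := chain b; exact: h.
have zj b m : (z b)@_m != 0 -> (mdeg m + i)%N = j.
  by have [_ h] := chain b; exact: twist_homog_deg h.
have in_d m : edge_monomial A m -> (d <= mdeg m)%N.
  case/edge_monomialP => G /Ad <- Gm; apply: leq_trans (card_msupport m).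
  exact: subset_leq_card.
have [lt_ij|le_ji] := ltnP (i + d) j; last first.
  exists 0; first by move=> b; rewrite ffunE; split; [exact: edge_ideal0 |
    by rewrite /twist_homog; case: ifP => _; rewrite ?rpred0].
  apply/ffunP => b; rewrite !ffunE big1 => [|c _]; last by rewrite ffunE mul0r.
  apply/esym/mpolyP => m; rewrite mcoeff0; apply/eqP/negP => /negP zm.
  have := in_d _ (zA _ _ zm); have := zj _ _ zm; move: ji le_ji; clear.
  by move/eqP; lia.
pose f := extend z.
have fA F m : (f F)@_m != 0 -> #|F| = i /\ edge_monomial A m.
  rewrite /f; have [cF|cF] := boolP (#|F| == i); last by rewrite extend_out // mcoeff0 eqxx.
  rewrite -[F]/(val (exist (fun F : {set 'I_n} => #|F| == i) _ cF)) extendE => /zA.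
  by split; first exact/eqP.
have f_closed F : kosz f F = 0 by exact: closed_kosz.
have /finite_choice[b hb] M : mdeg M = j -> exists b : {set 'I_n} -> K,
    (forall F : {set 'I_n}, F \subset msupport M -> #|F| = i.+1 -> b F != 0 ->
       edge_monomial A (M - mset F)%MM) /\
    (forall F, strand (msupport M) b F = mgrade f M F).
  move=> Mj; apply: (strand_exact d0 Ad cA) => [|F|F]; first by rewrite Mj.
    by rewrite /mgrade; case: ifP => [FM /fA[cF ?]|_]; [split | rewrite eqxx].
  have [FM|FM] := boolP (F \subset msupport M).
    by rewrite -mgrade_kosz // /mgrade FM f_closed mcoeff0.
  rewrite /strand big1 // => x _; rewrite /mgrade ifN ?mulr0 //.
  by apply: contra FM; apply: subset_trans; exact: subsetUr.
pose w F : {mpoly K[n]} := \sum_(m : 'X_{1..n < j.+1})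
  (if mdeg m == (j - i.+1)%N then b (m + mset F)%MM F else 0) *: 'X_[m].
have wE F m : (w F)@_m = if mdeg m == (j - i.+1)%N then b (m + mset F)%MM F else 0.
  rewrite /w (mcoeff_bounded _
    (fun m => if mdeg m == (j - i.+1)%N then b (m + mset F)%MM F else 0)).
  case: ltnP => // jm; case: eqP => // mj; lia.
have w_deg F m : (w F)@_m != 0 -> mdeg m = (j - i.+1)%N.
  by rewrite wE; case: (mdeg m =P _) => //; rewrite eqxx.
have le_ij : (i.+1 <= j)%N by lia.
pose ww := [ffun F : koszul_basis n i.+1 => w (val F)].
exists ww.
  move=> F; rewrite ffunE; split; last by apply: twist_homogE => // m; exact: w_deg.
  apply/edge_idealP => m wm; move: (wm); rewrite wE (w_deg _ _ wm) eqxx.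
  have cF := eqP (valP F).
  have [| h _] := hb (m + mset (val F))%MM.
    by rewrite mdegD mdeg_mset (w_deg _ _ wm) cF subnK.
  by move/h; rewrite addmK mset_leD; apply.
apply/ffunP => G; rewrite free_map_kosz; apply/mpolyP => m.
have cG := eqP (valP G).
pose M := (m + mset (val G))%MM.
have GM : val G \subset msupport M by exact: mset_leD.
have -> : (kosz (extend ww) (val G))@_m = mgrade (kosz (extend ww)) M (val G).
  by rewrite /mgrade GM addmK.
rewrite mgrade_kosz //.
have mgE x : x \in msupport M :\: val G ->
    mgrade (extend ww) M (x |: val G) = if mdeg M == j then b M (x |: val G) else 0.
  rewrite inE => /andP[xG xM]; have xGM : x |: val G \subset msupport M.
    by rewrite subUset sub1set xM.
  have cxG : #|x |: val G| == i.+1 by rewrite cardsU1 xG cG.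
  rewrite /mgrade xGM.
  rewrite -[X in extend _ X]/(val (exist (fun F : {set 'I_n} => #|F| == i.+1) _ cxG)).
  rewrite extendE ffunE /= wE submK ?mset_le //.
  have : (mdeg (M - mset (x |: val G)) + i.+1)%N = mdeg M.
    by rewrite -(eqP cxG) -mdeg_mset -mdegD submK // mset_le.
  by move=> <-; rewrite -(eqn_add2r i.+1) subnK.
rewrite /strand; under eq_bigr => x xM do rewrite mgE //.
case: eqP => Mj; last first.
  rewrite big1 => [|x _]; last by rewrite mulr0.
  apply/esym/eqP; apply/negP => /negP/zj; rewrite -cG -mdeg_mset -mdegD.
  exact: Mj.
have [_ h] := hb M Mj; rewrite [LHS]h /mgrade GM addmK.
by rewrite /f extendE.
Qed.

End KoszulComplex.

(** * The bipyramid *)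

Section Bipyramid.
Variables (K : fieldType) (d : nat).
Notation V := 'I_d.+2.
Implicit Types (F G H S : {set V}) (p x : V).

Definition apices : {set V} := [set ord0; ord_max].

(** Complements of circuits: removing a vertex of the base and an apex from the
    vertex set leaves the other apex and the rest of the base. *)
Definition mixed_pairs : {set {set V}} :=
  [set [set p; x] | p in apices, x in ~: apices].

Definition bipyramid : {set {set V}} := [set ~: S | S in mixed_pairs].

Lemma card_apices : #|apices| = 2. Proof. by rewrite cards2. Qed.

Lemma card_base : #|~: apices| = d.
Proof. by have := cardsC apices; rewrite card_apices card_ord => -[]. Qed.

Lemma disjoint_apices : [disjoint apices & ~: apices].
Proof. by rewrite -subsets_disjoint. Qed.

Lemma card_bipyramid : #|bipyramid| = 2 * d.
Proof.
rewrite card_imset; last exact: setC_inj.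
by rewrite card_pairs ?disjoint_apices // card_apices card_base.
Qed.

Lemma setC_bipyramid S : (~: S \in bipyramid) = (S \in mixed_pairs).
Proof. by rewrite mem_imset //; exact: setC_inj. Qed.

Lemma mixed_pair p x : p \in apices -> x \notin apices -> [set p; x] \in mixed_pairs.
Proof. by move=> pA xA; apply: imset2_f; rewrite // inE. Qed.

Lemma mixed_pair_split S : S \in mixed_pairs ->
  ~~ (S \subset apices) /\ ~~ (S \subset ~: apices).
Proof.
case/imset2P => p x pA; rewrite inE => xA ->.
by rewrite !subUset !sub1set !in_setC pA (negbTE xA).
Qed.

Lemma card_mixed S : S \in mixed_pairs -> #|S| = 2.
Proof.
case/imset2P => p x pA xA ->; rewrite cards2.
by case: eqVneq xA => // <-; rewrite inE pA.
Qed.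

Lemma card_compl_pair S : #|S| = 2 -> #|~: S| = d.
Proof. by move=> cS; have := cardsC S; rewrite cS card_ord => -[]. Qed.

Lemma exists_other (S : {set V}) x : 1 < #|S| -> exists2 y, y \in S & y != x.
Proof.
move=> cS; have : 0 < #|S :\ x|.
  rewrite -(ltn_add2l (x \in S)) -cardsD1 addn0.
  by apply: leq_ltn_trans cS; case: (x \in S).
by case/card_gt0P => y /setD1P[yx yS]; exists y.
Qed.

Lemma bipyramid_uniform : 1 < d -> uniform_clutter d bipyramid.
Proof.
move=> d1; split=> [F /imsetP[S /card_mixed cS ->]|]; first exact: card_compl_pair.
apply/setP => z; rewrite inE; apply/bigcupP.
have [p pA pz] : exists2 p, p \in apices & p != z by apply: exists_other; rewrite card_apices.
have [x xA xz] : exists2 x, x \in ~: apices & x != z by apply: exists_other; rewrite card_base.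
exists (~: [set p; x]).
  by rewrite setC_bipyramid mixed_pair //; move: xA; rewrite inE.
by rewrite !inE negb_or eq_sym pz eq_sym.
Qed.

Local Notation I := (edge_ideal K (clutter_compl d bipyramid)).

Lemma edge_monomial_compl S m : #|S| = 2 -> S \notin mixed_pairs ->
  ~: S \subset msupport m -> edge_monomial (clutter_compl d bipyramid) m.
Proof.
move=> cS SM Sm; apply/edge_monomialP; exists (~: S) => //.
by rewrite inE card_compl_pair ?eqxx // setC_bipyramid.
Qed.

Local Open Scope ring_scope.

(** The cycle v is the Koszul boundary of x^G e_(S0), where G is the circuit
    complementary to S0; x^G itself is not in the ideal.  Suppose v is also
    the boundary of some w over the ideal, and compare the squarefree components.
    Those of w vanish on all mixed pairs, so at a single apex the
    boundary of w only sees the pair of apices, up to sign the same value at both.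
    But v has component 0 at e0 and +-1 at e1. *)
Lemma bipyramid_nonlinear : (1 < d)%N -> ~ has_linear_resolution d I.
Proof.
move=> d1; have [x0 x0A _] : exists2 x, x \in ~: apices & x != ord0.
  by apply: exists_other; rewrite card_base.
have x0nA : x0 \notin apices by move: x0A; rewrite inE.
pose e1 : V := ord_max; pose e0 : V := ord0.
have e01 : e0 != e1 by [].
have e0A : e0 \in apices by rewrite !inE.
have e1A : e1 \in apices by rewrite !inE eqxx orbT.
have e1x0 : e1 != x0 by apply: contraNneq x0nA => <-.
have e0x0 : e0 != x0 by apply: contraNneq x0nA => <-.
pose S0 := [set e1; x0].
have cS0 : #|S0| = 2%N by rewrite cards2 e1x0.
pose one : 'X_{1..d.+2} := mset [set: V].
pose w0 : {ffun koszul_basis d.+2 2 -> {mpoly K[d.+2]}} :=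
  [ffun F => if val F == S0 then 'X_[one - mset S0] else 0].
pose v := free_map (@fr_diff _ _ (koszul K d.+2) 1) w0.
move=> /(_ 1%N d.+2)[|? [_ _ exact1]].
  by rewrite add1n neq_ltn ltnSn orbT.
have msup (S : {set V}) : msupport (one - mset S)%MM = ~: S.
  rewrite msupport_sub ?msupport_mset ?setTD // => x.
  by rewrite msetE inE.
have w0E F : extend w0 F = if F == S0 then 'X_[one - mset S0] else 0.
  have [cF|cF] := boolP (#|F| == 2%N).
    rewrite -[X in extend _ X]/(val (exist (fun F : {set V} => #|F| == 2%N) _ cF)).
    by rewrite extendE ffunE.
  by rewrite extend_out //; case: (F =P S0) cF => // ->; rewrite cS0.
have w0g : mgrade (extend w0) one =1 indicator S0 1.
  move=> F; rewrite /mgrade w0E /indicator -mset_le; case: eqP => [->|_].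
    by rewrite mset_le msupport_mset subsetT mcoeffX eqxx.
  by rewrite mcoeff0 if_same.
have one_sup (F : {set V}) : F \subset msupport one by rewrite msupport_mset subsetT.
have v_supp (b : koszul_basis d.+2 1) m : (v b)@_m != 0 ->
    m = (one - mset (val b))%MM /\ exists2 x, x \notin val b & x |: val b = S0.
  rewrite /v free_map_kosz /kosz raddf_sum /= => /eqP ne.
  case: (pickP (fun x => (x \notin val b) && (x |: val b == S0))) => [x /andP[xb /eqP xS]|no].
    split; last by exists x.
    apply/eqP; apply: contra_notT ne => nm; rewrite big1 // => y yb.
    rewrite mcoeffZ w0E; case: eqP => [yS|_]; last by rewrite mul0r mcoeff0 mulr0.
    rewrite -mpolyXD mcoeffX; case: eqP => [Em|_]; last by rewrite mulr0.
    case/eqP: nm; rewrite -Em -yS msetU1 // -submDA submK //.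
    apply/mnm_lepP => z; rewrite mnm1E mnmBE !msetE inE; case: eqP => // <-.
    by rewrite (negbTE yb).
  case: ne; rewrite big1 // => y yb; rewrite w0E ifN ?mul0r ?scaler0 ?mcoeff0 //.
  by have := no y; rewrite yb => /negbT.
have v_I (b : koszul_basis d.+2 1) : I (v b).
  apply/edge_idealP => m /v_supp[-> [x xb xS]].
  have sub (S : {set V}) : #|S| = 2%N -> S \notin mixed_pairs -> val b \subset S ->
      edge_monomial (clutter_compl d bipyramid) (one - mset (val b))%MM.
    by move=> cS SM bS; apply: edge_monomial_compl cS SM _; rewrite msup setCS.
  have : x \in S0 by rewrite -xS setU11.
  case/set2P => xe.
    have [x1 x1A x10] : exists2 y, y \in ~: apices & y != x0 by apply: exists_other; rewrite card_base.
    apply: (sub [set x0; x1]); first by rewrite cards2 eq_sym x10.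
      apply/negP => /mixed_pair_split[_]; rewrite subUset !sub1set x0A.
      by rewrite x1A.
    rewrite -(setU1K xb) xS xe setU1K; last by rewrite inE.
    exact: subsetUl.
  apply: (sub apices); first exact: card_apices.
    by apply/negP => /mixed_pair_split[]; rewrite subxx.
  rewrite -(setU1K xb) xS xe /S0 setUC setU1K; last by rewrite inE eq_sym.
  by rewrite sub1set.
have v_chain : tor_cycle I d.+2 v.
  split; last by apply/koszul_exactS; exists w0.
  move=> b; split; first exact: v_I.
  apply: twist_homogE => // m /v_supp[-> _].
  have := mdegD (one - mset (val b))%MM (mset (val b)).
  rewrite submK ?mset_le // !mdeg_mset (eqP (valP b)) cardsT card_ord.
  by rewrite /= addn1 subn1 => -[<-].
have [c [w chain]] := exact1 _ v_chain.
rewrite big_ord0 subr0 => /esym wv.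
(* w and w0 have the same boundary, hence so do their squarefree components. *)
have bal G : #|G| = 1%N -> strand setT (mgrade (extend w) one) G =
   strand setT (indicator S0 1) G.
  move=> cG; have <- : msupport one = setT by rewrite msupport_mset.
  have -> : strand (msupport one) (indicator S0 1) G =
      strand (msupport one) (mgrade (extend w0) one) G.
    by apply: eq_bigr => x _; rewrite w0g.
  by rewrite -!mgrade_kosz // /mgrade -!extend_free_map -wv.
have w_mixed0 F : F \in mixed_pairs -> mgrade (extend w) one F = 0.
  move=> FM; have cF := card_mixed FM; rewrite /mgrade one_sup.
  have cF' : #|F| == 2%N by rewrite cF.
  rewrite -[X in extend _ X]/(val (exist (fun F : {set V} => #|F| == 2%N) _ cF')) extendE.
  have [/edge_idealP wI _] := chain (exist (fun F : {set V} => #|F| == 2%N) _ cF').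
  apply/eqP; apply: contraT => /wI/edge_monomialP[G]; rewrite inE msup /= => /andP[/eqP cG GB] GF.
  case/negP: GB; suff -> : G = ~: F by rewrite setC_bipyramid.
  by apply/eqP; rewrite eqEcard GF cG (card_compl_pair cF) leqnn.
have apex p q : p \in apices -> q \in apices -> p != q ->
    strand setT (mgrade (extend w) one) [set p] = sgn K q [set p] * mgrade (extend w) one apices.
  move=> pA qA pq; have Epq : [set q; p] = apices.
    apply/eqP; rewrite eqEcard subUset !sub1set pA qA card_apices.
    by rewrite cards2 eq_sym pq.
  rewrite /strand (bigD1 q) /=; last by rewrite !inE eq_sym pq.
  rewrite Epq big1 ?addr0 // => x; rewrite !inE andbT => /andP[xp xq].
  rewrite w_mixed0 ?mulr0 // setUC; apply: mixed_pair => //.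
  by rewrite -Epq !inE negb_or xp xq.
have := bal [set e1]; rewrite cards1 => /(_ erefl).
have := bal [set e0]; rewrite cards1 => /(_ erefl).
rewrite (apex e0 e1) // (apex e1 e0) 1?eq_sym //.
rewrite [RHS]big1 => [|x _]; last first.
  rewrite /indicator; case: eqP => [/setP/(_ e0)|_]; last by rewrite mulr0.
  by rewrite !inE eqxx orbT (negbTE e01) (negbTE e0x0).
move/(congr1 (fun z => sgn K e1 [set e0] * z)); rewrite mulrA sgnK mul1r mulr0 => ->.
rewrite mulr0 /strand (bigD1 x0) /=; last by rewrite !inE eq_sym e1x0.
rewrite big1 => [|x /andP[_ xx0]]; last first.
  rewrite /indicator; case: eqP => [/setP/(_ x0)|_]; last by rewrite mulr0.
  by rewrite !inE eqxx orbT eq_sym (negbTE xx0) eq_sym (negbTE e1x0).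
rewrite /indicator [x0 |: _]setUC eqxx addr0 mulr1 => /esym/eqP.
by rewrite signr_eq0.
Qed.

End Bipyramid.

(* The inequality #|C| > 'C(n, d) - 2d is between integers; it is stated without
   subtraction because subtraction on nat is truncated. *)
Theorem proposition2p3 (K : fieldType) (d : nat) (hd : (1 < d)%N) :
  is_least (nonlinear_size K d) (2 * d)%N /\
  (forall (n : nat) (C : {set {set 'I_n}}),
     uniform_clutter d C -> ('C(n, d) < #|C| + 2 * d)%N ->
     has_linear_resolution d (edge_ideal K C)).
Proof.
have complK n (C : {set {set 'I_n}}) : (forall F, F \in C -> #|F| = d) ->
    clutter_compl d (clutter_compl d C) = C.
  move=> Cd; apply/setP => F; rewrite !inE negb_and negbK.
  by case: eqP => //= cF; apply/esym/negbTE/negP => /Cd.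
split; last first.
  move=> n C [Cd _] cC; apply: few_nonedges_linear => //; first exact: ltnW.
  have <- : #|[set F : {set 'I_n} | #|F| == d] :\: C| = #|clutter_compl d C|.
    by apply: eq_card => F; rewrite !inE andbC.
  have CD : C \subset [set F : {set 'I_n} | #|F| == d].
    by apply/subsetP => F /Cd cF; rewrite inE cF.
  rewrite cardsD (setIidPr CD) card_draws card_ord.
  by rewrite ltn_subLR //; move: (subset_leq_card CD); rewrite card_draws card_ord.
split.
  exists d.+2, (bipyramid d); split; [exact: bipyramid_uniform|exact: card_bipyramid|].
  exact: bipyramid_nonlinear.
move=> k [n [C [[Cd _] <- nonlin]]]; rewrite leqNgt; apply/negP => cC.
apply: nonlin; apply: few_nonedges_linear; first exact: ltnW.
  by move=> F; rewrite inE => /andP[/eqP].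
by rewrite complK.
Qed.
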